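(* There is an algorithm which, given two lists $A=\{\alpha_1,\dots,\alpha_N\}$ and $B=\{\beta_1,\dots,\beta_N\}$ of vectors in $\{0,1\}^D$, constructs two rooted trees $H$ and $G$, each with $O(ND)$ vertices and of depth $O(D)$, such that $H$ is isomorphic to a subtree of $G$ if and only if there exist $\alpha\in A$ and $\beta\in B$ that are orthogonal, i.e. for every $i\in[D]$, $\alpha[i]=0$ or $\beta[i]=0$.
   Context: For rooted trees $H$ and $G$, $H$ is isomorphic to a subtree of $G$ if there is an injective map $f$ from the vertices of $H$ to the vertices of $G$ with $f(\mathrm{root}(H))=\mathrm{root}(G)$ such that whenever $c$ is a child of $p$ in $H$, $f(c)$ is a child of $f(p)$ in $G$. The depth of a rooted tree is the maximum number of edges on a root-to-leaf path. *)

(* Defs.v *)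
From mathcomp Require Import all_boot.

Set Implicit Arguments.
Unset Strict Implicit.
Unset Printing Implicit Defensive.

(* Finite rooted trees; the order in which children are listed is only a matter
   of representation. *)
Inductive tree : Type := Node of seq tree.

(* A vertex is named by its address, the list of child indices followed when
   going down from the root; the root is [::]. *)
Fixpoint vertices (t : tree) : seq (seq nat) :=
  let: Node ts := t in
  let vs := map vertices ts in
  [::] :: flatten (mkseq (fun i => [seq i :: v | v <- nth [::] vs i]) (size ts)).

Definition root : seq nat := [::].

Definition child_of (t : tree) (c p : seq nat) : bool :=
  [&& c \in vertices t, p \in vertices t, prefix p c & size c == (size p).+1].

Definition leaf (t : tree) (v : seq nat) : bool :=
  ~~ has (fun c => child_of t c v) (vertices t).

Definition nvertices (t : tree) : nat := size (vertices t).

(* The length of an address is the number of edges between it and the root. *)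
Definition depth (t : tree) : nat :=
  \max_(v <- vertices t | leaf t v) size v.

Definition iso_to_subtree (H G : tree) : Prop :=
  exists f : seq nat -> seq nat,
    [/\ {in vertices H, forall v, f v \in vertices G},
        {in vertices H &, injective f},
        f root = root
      & forall c p, child_of H c p -> child_of G (f c) (f p)].

Definition orthogonal (D : nat) (alpha beta : D.-tuple bool) : Prop :=
  forall i : 'I_D, tnth alpha i = false \/ tnth beta i = false.

(* Algorithms are programs of Jones's WHILE language, a Turing-complete
   imperative language whose values are binary trees. *)
Inductive data : Type := Atom | Pair of data & data.

Inductive expr : Type :=
  | EVar of nat
  | EAtom
  | EPair of expr & expr
  | EFst of expr
  | ESnd of expr.

Inductive cmd : Type :=
  | Assign of nat & expr
  | Seq of cmd & cmd
  | While of expr & cmd.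

Definition store : Type := nat -> data.

Definition update (s : store) (x : nat) (d : data) : store :=
  fun y => if y == x then d else s y.

(* Both projections of Atom are Atom. *)
Definition fst_data (d : data) : data := if d is Pair a _ then a else Atom.
Definition snd_data (d : data) : data := if d is Pair _ b then b else Atom.

Fixpoint eval (s : store) (e : expr) : data :=
  match e with
  | EVar x => s x
  | EAtom => Atom
  | EPair e1 e2 => Pair (eval s e1) (eval s e2)
  | EFst e1 => fst_data (eval s e1)
  | ESnd e1 => snd_data (eval s e1)
  end.

(* In a loop guard, Atom is false and every other value is true. *)
Inductive exec : cmd -> store -> store -> Prop :=
  | exec_assign x e s : exec (Assign x e) s (update s x (eval s e))
  | exec_seq c1 c2 s1 s2 s3 :
      exec c1 s1 s2 -> exec c2 s2 s3 -> exec (Seq c1 c2) s1 s3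
  | exec_while_stop e c s : eval s e = Atom -> exec (While e c) s s
  | exec_while_step e c s1 s2 s3 :
      eval s1 e <> Atom -> exec c s1 s2 -> exec (While e c) s2 s3 ->
      exec (While e c) s1 s3.

(* Variable 0 holds the input at the start and the output at the end; all other
   variables start at Atom. *)
Definition computes (prog : cmd) (input output : data) : Prop :=
  exists s : store,
    exec prog (update (fun _ => Atom) 0 input) s /\ s 0 = output.

Definition enc_seq (ds : seq data) : data := foldr Pair Atom ds.

Definition enc_bool (b : bool) : data := if b then Pair Atom Atom else Atom.

Definition enc_vectors (N D : nat) (A : N.-tuple (D.-tuple bool)) : data :=
  enc_seq [seq enc_seq [seq enc_bool b | b <- val alpha] | alpha <- val A].

Fixpoint enc_tree (t : tree) : data :=
  let: Node ts := t in enc_seq (map enc_tree ts).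

(* Main.v *)
(* A bit vector is encoded as a caterpillar: a spine with one edge per bit and
   an extra leaf wherever the bit is 1.  With equal lengths, one caterpillar
   embeds in another iff its bits are dominated pointwise, so the caterpillar of
   alpha embeds in that of the complement of beta iff alpha and beta are
   orthogonal; reversing both vectors changes nothing.  Let the root of H carry
   the caterpillars of the N vectors of A and one full (all-ones) caterpillar,
   and the root of G those of the N complements of vectors of B and N full
   ones.  By pigeonhole some child of H lands in a complement of some beta; if
   it is the full one, then beta = 0.  Conversely an orthogonal pair is matched
   and the N remaining children of H go to the full caterpillars.  The extra
   child of H makes the construction correct for N = 0 as well. *)
Require Import Defs.
From mathcomp Require Import all_boot zify.

Set Implicit Arguments.
Unset Strict Implicit.
Unset Printing Implicit Defensive.

Notation leaf_tree := (Node [::]).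

(** * Addresses of vertices and the child relation *)

Lemma nil_in_vertices t : [::] \in vertices t.
Proof. by case: t => ts; rewrite /= inE. Qed.

Lemma cons_in_vertices ts i v :
  (i :: v \in vertices (Node ts)) =
  (i < size ts) && (v \in vertices (nth leaf_tree ts i)).
Proof.
rewrite /= inE /=; apply/flattenP/andP => [[s /mapP[j]]|[lti vin]].
  rewrite mem_iota /= => ltj -> /mapP[u uin [-> ->]].
  by rewrite (nth_map leaf_tree) in uin.
exists [seq i :: u | u <- nth [::] (map vertices ts) i].
  by apply/mapP; exists i => //; rewrite mem_iota.
by rewrite mem_map ?(nth_map leaf_tree) // => x y [].
Qed.

Lemma vertices_rcons t v k : rcons v k \in vertices t -> v \in vertices t.
Proof.
elim: v t => [|i v IHv] [ts]; first by rewrite nil_in_vertices.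
by rewrite rcons_cons !cons_in_vertices => /andP[-> /IHv].
Qed.

Lemma child_ofP t c p :
  reflect (exists2 k, c = rcons p k & c \in vertices t) (child_of t c p).
Proof.
apply: (iffP and4P) => [[cin _ /prefixP[s def_c]] | [k -> cin]].
  rewrite {1}def_c size_cat -addn1 eqn_add2l => sz1.
  case: s def_c sz1 => [|k []] // def_c _.
  by exists k; rewrite // def_c cats1.
by split; rewrite ?(vertices_rcons cin) ?prefix_rcons ?size_rcons.
Qed.

Lemma child_of_cons ts i j c p :
  child_of (Node ts) (i :: c) (j :: p) =
  [&& i == j, i < size ts & child_of (nth leaf_tree ts i) c p].
Proof.
rewrite /child_of !cons_in_vertices prefix_cons eqSS eq_sym.
by case: eqP => [->|]; rewrite ?andbF //=; case: ltnP.
Qed.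

(** * Embeddings, reduced to the branches at the root *)

(** Since the root and the edges are preserved, an embedding sends each branch at the root into one
    branch, and distinct branches into distinct ones; conversely, embeddings of the branches into
    distinct branches glue together. *)
Lemma iso_to_subtree_NodeP hs gs :
  iso_to_subtree (Node hs) (Node gs) <->
  exists g : nat -> nat,
    [/\ forall i, i < size hs -> g i < size gs,
        {in gtn (size hs) &, injective g}
      & forall i, i < size hs ->
          iso_to_subtree (nth leaf_tree hs i) (nth leaf_tree gs (g i))].
Proof.
split=> [[f [fin finj froot fchild]] | [g [gin ginj giso]]].
  (* By induction from the end of the address, everything below child [i] lands below the image of
     that child. *)
  have f_cons i v : i :: v \in vertices (Node hs) ->
      exists w, f (i :: v) = head 0 (f [:: i]) :: w.
    elim/last_ind: v => [|v k IHv] iv.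
      have : child_of (Node hs) [:: i] Defs.root by apply/child_ofP; exists i.
      by move/fchild/child_ofP; rewrite froot => -[k -> _]; exists [::].
    have /IHv[w fw] : i :: v \in vertices (Node hs).
      by apply: (@vertices_rcons _ _ k).
    have : child_of (Node hs) (i :: rcons v k) (i :: v).
      by apply/child_ofP; exists k.
    by move/fchild/child_ofP=> [l -> _]; exists (rcons w l); rewrite fw.
  have single i : i < size hs -> [:: i] \in vertices (Node hs).
    by move=> lti; rewrite cons_in_vertices lti nil_in_vertices.
  exists (fun i => head 0 (f [:: i])); split=> [i /single iin|i j lti ltj eqij|i lti].
  - have [w fw] := f_cons _ _ iin.
    by have := fin _ iin; rewrite fw cons_in_vertices => /andP[].
  - have [iin jin] := (single _ lti, single _ ltj).
    have ch k : [:: k] \in vertices (Node hs) ->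
        f [:: k] = [:: head 0 (f [:: k])].
      move=> kin; have : child_of (Node hs) [:: k] Defs.root by apply/child_ofP; exists k.
      by move/fchild/child_ofP; rewrite froot => -[l -> _].
    by have /finj : f [:: i] = f [:: j]; [rewrite ch // eqij -ch | case/(_ iin jin)].
  - set j := head 0 _.
    have f_in v : v \in vertices (nth leaf_tree hs i) ->
        i :: v \in vertices (Node hs).
      by rewrite cons_in_vertices lti.
    have fE v : v \in vertices (nth leaf_tree hs i) ->
        f (i :: v) = j :: behead (f (i :: v)).
      by move/f_in/f_cons => -[w ->].
    exists (fun v => behead (f (i :: v))); split.
    + move=> v vin; have := fin _ (f_in _ vin).
      by rewrite fE // cons_in_vertices => /andP[].
    + move=> u v uin vin eq_uv.
      have /finj : f (i :: u) = f (i :: v) by rewrite fE // eq_uv -fE.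
      by case/(_ (f_in _ uin) (f_in _ vin)).
    + have : child_of (Node hs) [:: i] Defs.root.
        by apply/child_ofP; exists i => //; exact: single.
      by move/fchild/child_ofP; rewrite froot => -[k -> _].
    + move=> c p cp; have /and4P[cin pin _ _] := cp.
      have : child_of (Node hs) (i :: c) (i :: p) by rewrite child_of_cons eqxx lti.
      by move/fchild; rewrite fE // (fE p) // child_of_cons => /and3P[].
have /fin_all_exists[fs fsP] : forall i : 'I_(size hs), exists f : seq nat -> seq nat,
    [/\ {in vertices (nth leaf_tree hs i),
          forall v, f v \in vertices (nth leaf_tree gs (g i))},
        {in vertices (nth leaf_tree hs i) &, injective f},
        f Defs.root = Defs.root
      & forall c p, child_of (nth leaf_tree hs i) c p ->
          child_of (nth leaf_tree gs (g i)) (f c) (f p)].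
  by move=> i; apply: giso.
(* The failure case of [insub] is met only at addresses outside the source tree. *)
exists (fun v => if v is i :: u then
                   g i :: (if insub i is Some o then fs o u else [::])
                 else [::]).
split=> //.
- move=> [|i v]; rewrite ?nil_in_vertices // cons_in_vertices => /andP[lti vin].
  rewrite insubT cons_in_vertices gin //=.
  by have [h _ _ _] := fsP (Ordinal lti); apply: h.
- move=> [|i u] [|j v] //; rewrite !cons_in_vertices => /andP[lti uin] /andP[ltj vin].
  case=> /ginj-/(_ lti ltj) eqij; subst j.
  rewrite !insubT; have [_ h _ _] := fsP (Ordinal lti).
  rewrite (bool_irrelevance ltj lti) => /h.
  by move=> -> //.
- move=> [|i c] p; first by case/child_ofP=> k; case: p.
  case: p => [|j p] => [/child_ofP[k [-> ->]]|].
    rewrite cons_in_vertices => /andP[ltk _].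
    apply/child_ofP; exists (g k); rewrite insubT /=.
      by have [_ _ -> _] := fsP (Ordinal ltk).
    by have [_ _ -> _] := fsP (Ordinal ltk); rewrite cons_in_vertices gin ?nil_in_vertices.
  rewrite child_of_cons => /and3P[/eqP <- lti cp].
  rewrite insubT child_of_cons eqxx gin //=.
  by have [_ _ _ h] := fsP (Ordinal lti); apply: h.
Qed.

Lemma iso_leaf_tree t : iso_to_subtree leaf_tree t.
Proof. by case: t => ts; apply/iso_to_subtree_NodeP; exists id; split. Qed.

(** * Caterpillars *)

(** Child 0 continues the spine; child 1, if present, is the leaf marking a bit 1. *)
Fixpoint caterpillar (bs : seq bool) : tree :=
  if bs is b :: bs' then Node (caterpillar bs' :: nseq b leaf_tree)
  else leaf_tree.

Lemma iso_caterpillar bs cs : size bs = size cs ->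
  iso_to_subtree (caterpillar bs) (caterpillar cs) <-> all2 implb bs cs.
Proof.
elim: bs cs => [|b bs IHbs] [|c cs] //=; first by split=> // _; apply: iso_leaf_tree.
case=> eqsz; rewrite -(rwP andP) -(IHbs _ eqsz) iso_to_subtree_NodeP /= !size_nseq.
split=> [[g [gin ginj giso]] | [bc iso_tl]].
  split.
    (* If [b] is true and [c] is false, two children would have to share the only child of the
       target. *)
    case: b gin ginj giso => //; case: c => // gin ginj _.
    have /ginj : g 0 = g 1 by have := gin 0 isT; have := gin 1 isT; lia.
    by move/(_ isT isT).
  (* The spine can be sent to the extra leaf of the target only if [bs] is empty, and then it embeds
     anywhere. *)
  have := giso 0 isT; have := gin 0 isT; case: (g 0) => [|[|k]] //=; last by case: (c).
  case: (c) => //= _; case: (bs) (eqsz) => [_ _|b' bs' _]; first exact: iso_leaf_tree.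
  by move/iso_to_subtree_NodeP=> [h [/(_ 0 isT)]].
exists id; split=> //; first by move: bc; case: (b); case: (c) => // _ [|[]].
case=> [|i] //=; case: b bc => //=; case: i => //= _ _; exact: iso_leaf_tree.
Qed.

Lemma iso_caterpillar_full e bs : size bs = e ->
  iso_to_subtree (caterpillar bs) (caterpillar (nseq e true)).
Proof.
move=> <-; apply/iso_caterpillar; rewrite ?size_nseq //.
by elim: bs => //= b bs ->; rewrite implybT.
Qed.

(** * Collections of caterpillars under a common root *)

(** [e = D] is asked only for nonempty [Ps], because a program given no vectors cannot read off [D].
    For empty [Ps] the source root has a child and the target root has none, so both sides are
    false. *)
Lemma iso_starP (D e : nat) (Ps Qs : seq (seq bool)) :
  size Qs = size Ps -> (0 < size Ps -> e = D) ->
  all (fun v => size v == D) Ps -> all (fun v => size v == D) Qs ->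
  iso_to_subtree
    (Node (caterpillar (nseq e true) :: map caterpillar Ps))
    (Node (map caterpillar Qs ++ nseq (size Ps) (caterpillar (nseq D true)))) <->
  exists P Q, [/\ P \in Ps, Q \in Qs & all2 implb P Q].
Proof.
move=> eqQP eD /allP-szP /allP-szQ; set n := size Ps in eqQP eD *.
rewrite iso_to_subtree_NodeP /= size_cat !size_map size_nseq eqQP.
split=> [[g [gin ginj giso]] | [P [Q [Pin Qin PQ]]]].
  (* Either some child lands among the caterpillars of [Qs], at an index below [n], or all land in
     the full ones. *)
  have [/hasP[i] | /hasPn no_i] := boolP (has (fun i => g i < n) (iota 0 n.+1)).
    rewrite mem_iota /= => lti ltg; have := giso i lti.
    rewrite nth_cat size_map eqQP ltg (nth_map [::]) ?eqQP //.
    have Qin : nth [::] Qs (g i) \in Qs by rewrite mem_nth ?eqQP.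
    have /eqP szg := szQ _ Qin.
    case: i lti ltg Qin szg => [|i] /= lti ltg Qin szg.
      (* Child 0 is the full caterpillar, so its target is all ones and dominates every vector; the
         first one of [Ps] serves. *)
      have n_gt0 : 0 < n by lia.
      rewrite iso_caterpillar ?size_nseq ?szg ?eD // => full.
      have Pin : nth [::] Ps 0 \in Ps by rewrite mem_nth.
      exists (nth [::] Ps 0), (nth [::] Qs (g 0)); split=> //.
      have /eqP := szP _ Pin; move: szg full.
      elim: (D) (nth _ Qs _) (nth _ Ps _) => [|k IHk] [|c cs] [|b bs] //=.
      by case=> szc /andP[-> full] [szb]; rewrite implybT; exact: IHk.
    rewrite (nth_map [::]) // => iso_i.
    have Pin : nth [::] Ps i \in Ps by rewrite mem_nth.
    exists (nth [::] Ps i), (nth [::] Qs (g i.+1)); split=> //.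
    by apply/iso_caterpillar => //; rewrite szg; apply/eqP/szP.
  (* Pigeonhole: n + 1 subtrees do not fit into the n full caterpillars. *)
  have uniq_g : uniq (map g (iota 0 n.+1)).
    rewrite map_inj_in_uniq ?iota_uniq // => i j.
    by rewrite !mem_iota /= => lti ltj; apply: ginj.
  have /(uniq_leq_size uniq_g) : {subset map g (iota 0 n.+1) <= iota n n}.
    move=> _ /mapP[i iin ->]; have := no_i _ iin.
    by move: iin; rewrite !mem_iota => /gin; lia.
  by rewrite size_map !size_iota ltnn.
have [p ltp def_P] : exists2 p, p < n & nth [::] Ps p = P.
  by exists (index P Ps); rewrite ?index_mem ?nth_index.
have [q ltq def_Q] : exists2 q, q < n & nth [::] Qs q = Q.
  by exists (index Q Qs); rewrite -?eqQP ?index_mem ?nth_index.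
(* Child [p.+1] is the caterpillar of [P], shifted by the full one at index 0. The others move up by
   [n], except that [n + n] is out of range: child [n] takes the slot [n + p.+1] that child [p.+1]
   leaves free. *)
exists (fun i => if i == p.+1 then q else if i == n then n + p.+1 else n + i).
split=> [i lti|i j|i lti].
- by case: eqP; [|case: eqP]; lia.
- rewrite !inE => lti ltj.
  by case: (eqVneq i p.+1); case: (eqVneq j p.+1);
     case: (eqVneq i n); case: (eqVneq j n); lia.
have n_gt0 : 0 < n by lia.
have -> : e = D by exact: eD.
case: eqVneq => [->|nep].
  rewrite /= nth_cat size_map eqQP ltq !(nth_map [::]) ?eqQP // def_P def_Q.
  by apply/iso_caterpillar => //; rewrite (eqP (szP _ Pin)) (eqP (szQ _ Qin)).
have full k : k < n ->
    nth leaf_tree (map caterpillar Qs ++ nseq n (caterpillar (nseq D true))) (n + k)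
    = caterpillar (nseq D true).
  by move=> ltk; rewrite nth_cat size_map eqQP ltnNge leq_addr addKn nth_nseq ltk.
have -> : (if i == n then n + p.+1 else n + i) = n + (if i == n then p.+1 else i).
  by case: ifP.
rewrite full; last by case: eqP; lia.
case: i lti nep => [|i] lti _ /=; first by apply: iso_caterpillar_full; rewrite size_nseq.
rewrite (nth_map [::]) //; apply: iso_caterpillar_full; apply/eqP/szP.
exact: mem_nth.
Qed.

(** * Number of vertices and depth *)

Lemma nvertices_Node ts : nvertices (Node ts) = (sumn (map nvertices ts)).+1.
Proof.
rewrite /nvertices /= size_flatten /shape -map_comp; congr (sumn _).+1.
rewrite -[RHS](mkseq_nth 0) size_map.
by apply/eq_in_map => i; rewrite mem_iota /= => lti; rewrite size_map !(nth_map leaf_tree).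
Qed.

Lemma nvertices_Node_le m ts :
  (forall i, i < size ts -> nvertices (nth leaf_tree ts i) <= m) ->
  nvertices (Node ts) <= (size ts * m).+1.
Proof.
rewrite nvertices_Node ltnS; elim: ts => //= t ts IHts le_m.
by rewrite mulSn leq_add ?(le_m 0) // IHts // => i; apply: (le_m i.+1).
Qed.

Lemma nvertices_caterpillar bs : nvertices (caterpillar bs) <= (size bs).*2.+1.
Proof.
elim: bs => //= b bs IHbs; rewrite nvertices_Node /= map_nseq sumn_nseq.
by rewrite /nvertices /= -/(nvertices _); case: b; lia.
Qed.

Lemma size_vertices_caterpillar bs v :
  v \in vertices (caterpillar bs) -> size v <= size bs.
Proof.
elim: bs v => [|b bs IHbs] [|i v] //; rewrite cons_in_vertices => /andP[] //.
case: i => [_ /IHbs //|i] /=; rewrite ltnS size_nseq => lti.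
by rewrite nth_nseq lti inE => /eqP ->.
Qed.

Lemma depth_Node_le d ts :
  (forall i v, i < size ts -> v \in vertices (nth leaf_tree ts i) -> size v <= d) ->
  depth (Node ts) <= d.+1.
Proof.
move=> le_d; apply/bigmax_leqP_seq => -[|i v] //.
by rewrite cons_in_vertices => /andP[lti vin] _; apply: le_d vin.
Qed.

(** * The program *)

Definition const (b : bool) : expr := if b then EPair EAtom EAtom else EAtom.

(* Registers: 0 input and output, 1 the finished H, 2 the vectors still to be
   read, 3 the children collected so far, 4 the unread part of the current
   vector, 5 its caterpillar, 6 the full caterpillar of the same length, 7 and 8
   the current bit.  The flag p asks for complementation. *)
Definition read_bit (p : bool) : cmd :=
  Seq (Assign 7 (const p))
 (Seq (Assign 8 (EFst (EVar 4)))
      (While (EVar 8) (Seq (Assign 7 (const (~~ p))) (Assign 8 EAtom)))).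

Definition read_vector (p : bool) : cmd :=
  While (EVar 4)
   (Seq (read_bit p)
   (Seq (Assign 5 (EPair (EVar 5) (EVar 7)))
   (Seq (Assign 6 (EPair (EVar 6) (const true)))
        (Assign 4 (ESnd (EVar 4)))))).

(** [k] selects what is collected: register 5, the caterpillar of the vector, or register 6, the
    full one. *)
Definition read_vectors (p : bool) (k : nat) : cmd :=
  While (EVar 2)
   (Seq (Assign 4 (EFst (EVar 2)))
   (Seq (Assign 5 EAtom)
   (Seq (Assign 6 EAtom)
   (Seq (read_vector p)
   (Seq (Assign 3 (EPair (EVar k) (EVar 3)))
        (Assign 2 (ESnd (EVar 2)))))))).

(** The second list is read twice. Children are collected at the front, so reading for the full
    caterpillars first puts them after the complements. Register 6, left over from the first list,
    supplies the extra child of H. *)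
Definition build : cmd :=
  Seq (Assign 2 (EFst (EVar 0)))
 (Seq (read_vectors false 5)
 (Seq (Assign 1 (EPair (EVar 6) (EVar 3)))
 (Seq (Assign 3 EAtom)
 (Seq (Assign 2 (ESnd (EVar 0)))
 (Seq (read_vectors true 6)
 (Seq (Assign 2 (ESnd (EVar 0)))
 (Seq (read_vectors true 5)
      (Assign 0 (EPair (EVar 1) (EVar 3)))))))))).

(** * Correctness of the program *)

Definition enc_bits (v : seq bool) : data := enc_seq (map enc_bool v).

Lemma eval_const s b : eval s (const b) = enc_bool b.
Proof. by case: b. Qed.

(** [enc_bool b] is also the encoding of a list of [b] leaves, so prepending a bit to a caterpillar
    takes a single pairing. *)
Lemma enc_caterpillar_cons b bs :
  enc_tree (caterpillar (b :: bs)) = Pair (enc_tree (caterpillar bs)) (enc_bool b).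
Proof. by case: b. Qed.

(** The loop acts as a conditional: its body clears register 8 and so runs at most once. *)
Lemma exec_read_bit p b d s : s 4 = Pair (enc_bool b) d ->
  exists s', [/\ exec (read_bit p) s s', s' 7 = enc_bool (p (+) b)
                & forall x, x < 7 -> s' x = s x].
Proof.
move=> s4; pose s1 := update s 7 (enc_bool p); pose s2 := update s1 8 (enc_bool b).
have ex_init c s' : exec c s2 s' ->
    exec (Seq (Assign 7 (const p)) (Seq (Assign 8 (EFst (EVar 4))) c)) s s'.
  move=> ex_c; apply: (exec_seq (s2 := s1)).
    by rewrite /s1 -(eval_const s); apply: exec_assign.
  apply: exec_seq ex_c; rewrite /s2 [enc_bool b](_ : _ = eval s1 (EFst (EVar 4))).
    exact: exec_assign.
  by rewrite /= /s1 /update /= s4.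
case: b {s4} @s2 ex_init => s2 ex_init.
  exists (update (update s2 7 (enc_bool (~~ p))) 8 Atom); split.
  - apply: ex_init; apply: exec_while_step => //; last exact: exec_while_stop.
    apply: exec_seq; first exact: exec_assign.
    by rewrite eval_const; apply: exec_assign.
  - by rewrite /update /= addbT.
  - by rewrite /s2 /s1 /update => x ltx; do 4?case: eqP => //; lia.
exists s2; split.
- by apply: ex_init; apply: exec_while_stop.
- by rewrite /s2 /s1 /update /= addbF.
- by rewrite /s2 /s1 /update => x ltx; do 2?case: eqP => //; lia.
Qed.

(** The accumulators [w] and [n] serve the induction on [v]. The first bit read ends deepest, whence
    the reversal. *)
Lemma exec_read_vector p v w n s :
  s 4 = enc_bits v -> s 5 = enc_tree (caterpillar w) ->
  s 6 = enc_tree (caterpillar (nseq n true)) ->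
  exists s', [/\ exec (read_vector p) s s',
    s' 5 = enc_tree (caterpillar (catrev (map (addb p) v) w)),
    s' 6 = enc_tree (caterpillar (nseq (size v + n) true))
    & forall x, x < 4 -> s' x = s x].
Proof.
elim: v w n s => [|b v IHv] w n s s4 s5 s6.
  by exists s; split=> //; apply: exec_while_stop.
have [s1 [ex1 s17 s1E]] := exec_read_bit p s4.
pose s2 := update s1 5 (Pair (s1 5) (s1 7)).
pose s3 := update s2 6 (Pair (s2 6) (enc_bool true)).
pose s4' := update s3 4 (snd_data (s3 4)).
have [||| s' [ex' s'5 s'6 s'E]] := IHv ((p (+) b) :: w) n.+1 s4'.
- by rewrite /s4' /s3 /s2 /update /= s1E // s4.
- by rewrite enc_caterpillar_cons /s4' /s3 /s2 /update /= s1E // s5 s17.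
- by rewrite enc_caterpillar_cons /s4' /s3 /s2 /update /= s1E // s6.
exists s'; split=> //.
- apply: exec_while_step ex'; first by rewrite /= s4.
  apply: exec_seq ex1 _.
  apply: (exec_seq (s2 := s2)); first exact: exec_assign.
  apply: (exec_seq (s2 := s3)); first exact: exec_assign.
  exact: exec_assign.
- by rewrite s'6 addnS.
- move=> x ltx; rewrite s'E // /s4' /s3 /s2 /update.
  by rewrite -(s1E x) ?(leq_trans ltx) //; do 3?case: eqP => //; lia.
Qed.

(* Register 5 lists the (complemented) vectors backwards, register 6 the full
   caterpillars. *)
Definition collected (p : bool) (k : nat) (v : seq bool) : tree :=
  caterpillar (if k == 5 then rev (map (addb p) v) else nseq (size v) true).

(** Register 6 is tracked because its last content becomes the extra child of H. *)
Lemma exec_read_vectors p k vs ts s : k \in [:: 5; 6] ->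
  s 2 = enc_seq (map enc_bits vs) -> s 3 = enc_seq (map enc_tree ts) ->
  exists s', [/\ exec (read_vectors p k) s s',
    s' 3 = enc_seq (map enc_tree (catrev (map (collected p k) vs) ts)),
    s' 6 = last (s 6) [seq enc_tree (caterpillar (nseq (size v) true)) | v <- vs]
    & forall x, x < 2 -> s' x = s x].
Proof.
move=> k56; elim: vs ts s => [|v vs IHvs] ts s s2 s3.
  by exists s; split=> //; apply: exec_while_stop.
pose t1 := update s 4 (fst_data (s 2)).
pose t2 := update (update t1 5 Atom) 6 Atom.
have [||| t3 [ex3 t35 t36 t3E]] := @exec_read_vector p v [::] 0 t2 => //.
  by rewrite /t2 /t1 /update /= s2.
pose t4 := update t3 3 (Pair (t3 k) (t3 3)).
pose t5 := update t4 2 (snd_data (t4 2)).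
have [|| s' [ex' s'3 s'6 s'E]] := IHvs (collected p k v :: ts) t5.
- by rewrite /t5 /t4 /update /= t3E // /t2 /t1 /update /= s2.
- rewrite /t5 /t4 /update /= (t3E 3) // /t2 /t1 /update /= s3; congr Pair.
  move: k56; rewrite !inE /collected => /orP[]/eqP -> /=; first by rewrite t35.
  by rewrite t36 addn0.
exists s'; split=> //.
- apply: exec_while_step ex'; first by rewrite /= s2.
  apply: (exec_seq (s2 := t1)); first exact: exec_assign.
  apply: exec_seq; first exact: exec_assign.
  apply: (exec_seq (s2 := t2)); first exact: exec_assign.
  apply: exec_seq ex3 _.
  by apply: (exec_seq (s2 := t4)); apply: exec_assign.
- by rewrite s'6 /t5 /t4 /update /= t36 addn0.
- move=> x ltx; rewrite s'E // /t5 /t4 {1 2}/update.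
  have [xn2 xn3] : x != 2 /\ x != 3 by lia.
  rewrite (negPf xn2) (negPf xn3) t3E ?(leq_trans ltx) // /t2 /t1 /update.
  by do 3?case: eqP => //; lia.
Qed.

(** [last 0 (map size va)] is the length of the full caterpillar left in register 6: that of the
    last vector of [va], or 0 if there is none, since [Atom] encodes a single leaf. *)
Lemma computes_build (va vb : seq (seq bool)) :
  computes build (Pair (enc_seq (map enc_bits va)) (enc_seq (map enc_bits vb)))
    (Pair
      (enc_tree (Node (caterpillar (nseq (last 0 (map size va)) true)
                       :: rev (map (collected false 5) va))))
      (enc_tree (Node (rev (map (collected true 5) vb)
                       ++ rev (map (collected true 6) vb))))).
Proof.
set input := Pair _ _; pose s0 := update (fun _ => Atom) 0 input.
pose s1 := update s0 2 (enc_seq (map enc_bits va)).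
have [||| s2 [ex2 s23 s26 s2E]] := @exec_read_vectors false 5 va [::] s1 => //.
pose s3 := update s2 1 (Pair (s2 6) (s2 3)).
pose s4 := update s3 3 Atom.
pose s5 := update s4 2 (snd_data (s4 0)).
have in5 : s5 0 = input by rewrite /s5 /s4 /s3 /update /= s2E.
have [||| s6 [ex6 s63 _ s6E]] := @exec_read_vectors true 6 vb [::] s5 => //.
  by rewrite /s5 /s4 /s3 /update /= s2E.
pose s7 := update s6 2 (snd_data (s6 0)).
have [||| s8 [ex8 s83 _ s8E]] :=
    @exec_read_vectors true 5 vb (rev (map (collected true 6) vb)) s7 => //.
  by rewrite /s7 /update /= s6E // in5.
exists (update s8 0 (Pair (s8 1) (s8 3))); split.
  apply: (exec_seq (s2 := s1)); first exact: exec_assign.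
  apply: exec_seq ex2 _.
  apply: (exec_seq (s2 := s3)); first exact: exec_assign.
  apply: (exec_seq (s2 := s4)); first exact: exec_assign.
  apply: (exec_seq (s2 := s5)); first exact: exec_assign.
  apply: exec_seq ex6 _.
  apply: (exec_seq (s2 := s7)); first exact: exec_assign.
  by apply: exec_seq ex8 _; apply: exec_assign.
rewrite {1}/update /= s83 catrevE s8E // /s7 /update /= s6E // /s5 /s4 /s3 /update /=.
rewrite s26 s23 /=; congr (Pair (Pair _ _) _).
rewrite (_ : s1 6 = enc_tree (caterpillar (nseq 0 true))) //.
by elim: (va) 0 => //= v vs IHvs n; rewrite IHvs.
Qed.

(** * Orthogonality and the assembly of the reduction *)

Lemma map_const_nseq (S T : Type) (f : S -> T) (c : T) s :
  (forall x, f x = c) -> map f s = nseq (size s) c.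
Proof. by move=> fc; elim: s => //= x s ->; rewrite fc. Qed.

(** [addb true] negates, so domination says that [alpha[i]] implies not [beta[i]]. Both vectors are
    reversed, as the program leaves them. *)
Lemma orthogonalE D (alpha beta : D.-tuple bool) :
  orthogonal alpha beta <->
  all2 implb (rev (map (addb false) alpha)) (rev (map (addb true) beta)).
Proof.
rewrite all2E !size_rev !size_map !size_tuple eqxx /= -rev_zip ?size_map ?size_tuple //.
rewrite all_rev; split=> [orth | /all_nthP-/(_ (false, false)) h i].
  apply/(all_nthP (false, false)) => i.
  rewrite size_zip !size_map !size_tuple minnn => lti.
  rewrite nth_zip ?size_map ?size_tuple //= !(nth_map false) ?size_tuple //.
  by have := orth (Ordinal lti); rewrite !(tnth_nth false) /=; case=> ->; rewrite ?implybT.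
have := h i; rewrite size_zip !size_map !size_tuple minnn ltn_ord => /(_ isT).
rewrite nth_zip ?size_map ?size_tuple //= !(nth_map false) ?size_tuple //.
by rewrite !(tnth_nth false); case: nth; case: nth; auto.
Qed.

Theorem theorem2p1 :
  exists (prog : cmd) (Csize Cdepth : nat),
  forall (N D : nat) (A B : N.-tuple (D.-tuple bool)),
  exists H G : tree,
    [/\ computes prog (Pair (enc_vectors A) (enc_vectors B))
                      (Pair (enc_tree H) (enc_tree G)),
        0 < N -> 0 < D ->
          nvertices H <= Csize * (N * D) /\ nvertices G <= Csize * (N * D),
        0 < D -> depth H <= Cdepth * D /\ depth G <= Cdepth * D
      & iso_to_subtree H G <->
        exists alpha beta : D.-tuple bool,
          [/\ alpha \in A, beta \in B & orthogonal alpha beta]].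
Proof.
(* For N, D >= 1 both trees have at most 2N(2D + 1) + 1 <= 7ND vertices, and depth at most D + 1 <=
   2D. *)
exists build, 7, 2 => N D A B.
pose va := map val A; pose vb := map val B.
pose e := last 0 (map size va).
(* Two reversals: the program prepends vectors to the list and bits to each caterpillar. *)
pose Ps := rev [seq rev (map (addb false) v) | v <- va].
pose Qs := rev [seq rev (map (addb true) v) | v <- vb].
pose H := Node (caterpillar (nseq e true) :: map caterpillar Ps).
pose G := Node (map caterpillar Qs ++ nseq (size Ps) (caterpillar (nseq D true))).
have szPs : size Ps = N by rewrite size_rev !size_map size_tuple.
have szQs : size Qs = N by rewrite size_rev !size_map size_tuple.
have szP : all (fun v => size v == D) Ps.
  by rewrite all_rev !all_map; apply/allP => v _ /=; rewrite size_rev size_map size_tuple.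
have szQ : all (fun v => size v == D) Qs.
  by rewrite all_rev !all_map; apply/allP => v _ /=; rewrite size_rev size_map size_tuple.
have eE : e = if N is 0 then 0 else D.
  have -> : e = last 0 (nseq N D).
    rewrite /e -map_comp (map_const_nseq (c := D)) ?size_tuple // => v.
    by rewrite /= size_tuple.
  by case: (N) => //= n; elim: n.
have le_e : e <= D by rewrite eE; case: (N).
have childH i : i < size (caterpillar (nseq e true) :: map caterpillar Ps) ->
    exists2 bs, size bs <= D &
      nth leaf_tree (caterpillar (nseq e true) :: map caterpillar Ps) i = caterpillar bs.
  case: i => [|i] /=; first by exists (nseq e true); rewrite ?size_nseq.
  rewrite ltnS size_map => lti; exists (nth [::] Ps i); last exact: nth_map.
  by rewrite (eqP (allP szP _ (mem_nth _ lti))).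
have childG i : i < size (map caterpillar Qs ++ nseq (size Ps) (caterpillar (nseq D true))) ->
    exists2 bs, size bs <= D &
      nth leaf_tree (map caterpillar Qs ++ nseq (size Ps) (caterpillar (nseq D true))) i
      = caterpillar bs.
  rewrite size_cat nth_cat size_map size_nseq szQs szPs => lti.
  case: ifP => [ltiN|geN].
    exists (nth [::] Qs i); last by rewrite (nth_map [::]) // szQs.
    by rewrite (eqP (allP szQ _ _)) ?mem_nth ?szQs.
  exists (nseq D true); first by rewrite size_nseq.
  by rewrite nth_nseq ifT //; lia.
exists H, G; split.
- have := computes_build va vb.
  rewrite /enc_vectors /H /G /e /va /vb -!map_comp.
  rewrite !map_rev -!map_comp /collected /=.
  have -> : rev [seq caterpillar (nseq (size (val v)) true) | v <- B] =
            nseq (size Ps) (caterpillar (nseq D true)).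
    rewrite (map_const_nseq (c := caterpillar (nseq D true))) => [|v].
      by rewrite szPs size_tuple rev_nseq.
    by rewrite size_tuple.
  exact.
- move=> N_gt0 D_gt0; split.
    have /leq_trans->// : nvertices H <= (N.+1 * D.*2.+1).+1.
      have -> : N.+1 = size (caterpillar (nseq e true) :: map caterpillar Ps).
        by rewrite /= size_map szPs.
      apply: nvertices_Node_le => i /childH[bs le_bs ->].
      by apply: leq_trans (nvertices_caterpillar _) _; lia.
    nia.
  have /leq_trans->// : nvertices G <= ((N + N) * D.*2.+1).+1.
    have -> : N + N = size (map caterpillar Qs ++ nseq (size Ps) (caterpillar (nseq D true))).
      by rewrite size_cat size_map size_nseq szPs szQs.
    apply: nvertices_Node_le => i /childG[bs le_bs ->].
    by apply: leq_trans (nvertices_caterpillar _) _; lia.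
  nia.
- move=> D_gt0; have le_D : D.+1 <= 2 * D by lia.
  split; apply: leq_trans le_D; apply: depth_Node_le => i v.
    by move/childH=> [bs le_bs ->] /size_vertices_caterpillar/leq_trans; apply.
  by move/childG=> [bs le_bs ->] /size_vertices_caterpillar/leq_trans; apply.
rewrite iso_starP ?szPs ?szQs //; last by rewrite eE; case: (N).
split=> [[P [Q [Pin Qin PQ]]] | [a [b [ain bin /orthogonalE ab]]]].
  move: Pin Qin PQ; rewrite !mem_rev -!map_comp.
  move=> /mapP[a ain ->] /mapP[b bin ->] /orthogonalE ab.
  by exists a, b.
exists (rev (map (addb false) a)), (rev (map (addb true) b)).
by rewrite !mem_rev -!map_comp; split=> //; apply/mapP; [exists a | exists b].
Qed.
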